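(* If $\mathcal{P}$ is a simplex-like poset, then there is an adequate covering family for the bounded above graded poset $\mathcal{P}^{op}$.
   Context: A poset is regarded as a category with exactly one arrow $p\to p'$ when $p\le p'$. A poset $\mathcal{P}$ is simplex-like if for every $p\in\mathcal{P}$ the subposet $\{q\in\mathcal{P}: q\le p\}$ is isomorphic to the poset of all non-empty subsets of some finite set $T$, ordered by inclusion; put $\deg(p)=|T|-1$. Then $\mathcal{Q}=\mathcal{P}^{op}$ is a graded poset with decreasing degree function $\deg$ with values in $\{0,1,2,\dots\}$ (i.e. $\deg$ is strictly order reversing on $\mathcal{Q}$ and drops by exactly $1$ along covering relations of $\mathcal{Q}$). For an object $i$ of $\mathcal{Q}$, $(i\downarrow\mathcal{Q})_n$ is the set of objects $j\ge i$ (in $\mathcal{Q}$) with $\deg(j)=n$, and $(i\downarrow\mathcal{Q})_*$ is the full subcategory on the objects $j>i$. A covering family for $\mathcal{Q}$ is a family $\mathcal{J}=\{J^{i_0}_p\}$ indexed by objects $i_0$ and integers $0\le p\le\deg(i_0)$, with $J^{i_0}_p\subseteq(i_0\downarrow\mathcal{Q})_p$, such that for each $i_0$ and $0\le p<\deg(i_0)$: (a) $\bigcup_{i\in J^{i_0}_{p+1}}(i\downarrow\mathcal{Q})_p=(i_0\downarrow\mathcal{Q})_p$; (b) $J^i_p\subseteq J^{i_0}_p$ for every $i\in J^{i_0}_{p+1}$. Define integers $R^{i_0}_p$ for $\deg(i_0)\ge p\ge 0$ by $R^{i_0}_0=1$ and $R^{i_0}_p=\sum_{i\in(i_0\downarrow\mathcal{Q})_{p-1}}R^i_{p-1}-R^{i_0}_{p-1}$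 for $p\ge1$. $\mathcal{J}$ is adequate if $(i_0\downarrow\mathcal{Q})_*$ is connected whenever $\deg(i_0)\ge2$, and $R^{i_0}_p=\sum_{i\in J^{i_0}_p}R^i_p$ for all $p\ge0$ and all $i_0$ with $\deg(i_0)\ge p+1$. *)

(* Defs.v *)
From HB Require Import structures.
From mathcomp Require Import all_boot all_order all_algebra.
From mathcomp Require Import boolp classical_sets functions cardinality fsbigop.

Set Implicit Arguments.
Unset Strict Implicit.
Unset Printing Implicit Defensive.

Import Order.TTheory GRing.Theory.

Local Open Scope classical_set_scope.
Local Open Scope order_scope.

Section GradedPosets.
Context {d : Order.disp_t} {Q : porderType d}.

Definition covering (x y : Q) : Prop :=
  x < y /\ ~ exists z, x < z /\ z < y.

(* As degrees lie in nat they are bounded below, i.e. a poset graded by such a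
   decreasing degree function is bounded above. *)
Record decreasing_degree := DecreasingDegree {
  degree :> Q -> nat ;
  degree_lt : forall x y : Q, x < y -> (degree y < degree x)%N ;
  degree_covering :
    forall x y : Q, covering x y -> degree x = (degree y).+1 }.

Definition above (i : Q) : set Q := [set j | i < j].

(* Connectedness of the full subcategory on [A]: non-empty, and any two objects
   are joined inside [A] by a zigzag of arrows. *)
Definition poset_connected (A : set Q) : Prop :=
  A !=set0 /\
  forall x y, A x -> A y ->
    exists s : seq Q, [/\ path >=<%O x s, last x s = y & [set` s] `<=` A].

Variable deg : decreasing_degree.

Definition above_deg (i : Q) (n : nat) : set Q :=
  [set j | i <= j /\ deg j = n].

(* Only the sets [J i0 p] with [p <= deg i0] are meaningful. *)
Definition covering_family (J : Q -> nat -> set Q) : Prop :=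
  (forall i0 p, (p <= deg i0)%N -> J i0 p `<=` above_deg i0 p) /\
  (forall i0 p, (p < deg i0)%N ->
     \bigcup_(i in J i0 p.+1) above_deg i p = above_deg i0 p /\
     forall i, J i0 p.+1 i -> J i p `<=` J i0 p).

(* Only the values [R p i0] with [p <= deg i0] are meaningful.  A sum over an
   infinite support is 0 by convention; this does not occur for the opposite
   of a simplex-like poset, see [finite_above_deg] below. *)
Fixpoint R (p : nat) (i0 : Q) : int :=
  match p with
  | 0%N => 1%R
  | p'.+1 => (\sum_(i \in above_deg i0 p') R p' i - R p' i0)%R
  end.

Definition adequate (J : Q -> nat -> set Q) : Prop :=
  (forall i0, (2 <= deg i0)%N -> poset_connected (above i0)) /\
  (forall i0 p, (p.+1 <= deg i0)%N ->
     R p i0 = (\sum_(i \in J i0 p) R p i)%R).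

End GradedPosets.

Arguments decreasing_degree {d} Q.

Section SimplexLike.
Context {d : Order.disp_t} {P : porderType d}.

Definition nonempty_subset (T : finType) := {A : {set T} | A != finset.set0}.

Definition lower (p : P) := {q : P | q <= p}.

Definition is_simplex (p : P) (T : finType) : Prop :=
  exists f : lower p -> nonempty_subset T,
    bijective f /\
    forall x y, (val (f x) \subset val (f y)) = (val x <= val y).

End SimplexLike.
Definition simplex_like {d : Order.disp_t} (P : porderType d) : Prop :=
  forall p : P, exists T : finType, is_simplex p T.

Section SimplexDegree.
Context {d : Order.disp_t} {P : porderType d}.

Lemma is_simplex_face (p q : P) (T U : finType)
    (f : lower p -> nonempty_subset T) (Hq : q <= p) :
    bijective f ->
    (forall x y, (val (f x) \subset val (f y)) = (val x <= val y)) ->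
  is_simplex q U -> #|U| = #|val (f (exist _ q Hq))|.
Proof.
move=> bf fM [g [[g' gg' g'g] gM]].
have [f' ff' f'f] := bf.
have g'M A B : (val (g' A) <= val (g' B)) = (val A \subset val B).
  by rewrite -gM !g'g.
pose w (A : nonempty_subset U) : lower p :=
  exist _ (val (g' A)) (le_trans (valP (g' A)) Hq).
pose h A := val (f (w A)).
have hinj : injective h.
  move=> A B /val_inj /(bij_inj bf) /(congr1 val) /= /val_inj.
  exact: (can_inj g'g).
set X := val _.
have cardN (V : finType) (Y : {set V}) :
    #|(powerset Y :\ finset.set0)%SET| = (2 ^ #|Y|).-1.
  have := cardsD1 finset.set0 (powerset Y).
  by rewrite finset.powersetE finset.sub0set finset.card_powerset /= add1n => ->.
have im : (h @: [set: nonempty_subset U] = powerset X :\ finset.set0)%SET.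
  apply/setP => B; rewrite !finset.inE; apply/imsetP/andP => /=.
    move=> [A _ ->]; split; first exact: (valP (f (w A))).
    by rewrite fM /=; exact: (valP (g' A)).
  move=> [B0 BX].
  have e : f (f' (exist _ B B0)) = exist _ B B0 by rewrite f'f.
  have le : val (f' (exist _ B B0)) <= q.
    by rewrite -[q]/(val (exist (fun q => is_true (q <= p)) q Hq)) -fM e.
  exists (g (exist _ (val (f' (exist _ B B0))) le)); first by rewrite finset.inE.
  rewrite /h; set z := w _.
  suff -> : z = f' (exist _ B B0) by rewrite f'f.
  by apply: val_inj; rewrite /z /= gg'.
have := card_imset [set: nonempty_subset U]%SET hinj.
rewrite im cardN cardsT card_sig => E.
have E2 : #|[pred A : {set U} | A != finset.set0]| = (2 ^ #|U|).-1.
  rewrite -(cardsT U) -cardN; apply: eq_card => A.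
  by rewrite !finset.inE finset.subsetT andbT.
move: E; rewrite E2 => /(congr1 succn).
by rewrite !prednK ?expn_gt0 // => /eqP; rewrite eqn_exp2l // => /eqP ->.
Qed.

Hypothesis HP : simplex_like P.

Definition simplex_degree (p : P) : nat := #|projT1 (cid (HP p))|.-1.

Lemma simplex_degreeE (p : P) (T : finType) :
  is_simplex p T -> simplex_degree p = #|T|.-1.
Proof.
rewrite /simplex_degree; case: cid => U /= HU HT.
have [f [bf fM]] := HT.
rewrite (is_simplex_face (lexx p) bf fM HU).
by rewrite (is_simplex_face (lexx p) bf fM HT).
Qed.

Lemma simplex_degree_face (p q : P) (T : finType)
    (f : lower p -> nonempty_subset T) (Hq : q <= p) :
    bijective f ->
    (forall x y, (val (f x) \subset val (f y)) = (val x <= val y)) ->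
  (simplex_degree q).+1 = #|val (f (exist _ q Hq))|.
Proof.
move=> bf fM; have [U HU] := HP q.
rewrite (simplex_degreeE HU) (is_simplex_face Hq bf fM HU) prednK //.
by rewrite card_gt0; exact: (valP (f _)).
Qed.

Lemma simplex_degree_lt (x y : P^d) :
  x < y -> (simplex_degree y < simplex_degree x)%N.
Proof.
change (@Order.lt d P y x -> (simplex_degree y < simplex_degree x)%N) => yx.
have [T [f [bf fM]]] := HP x.
rewrite -ltnS (simplex_degree_face (ltW yx) bf fM).
rewrite (simplex_degree_face (lexx (x : P)) bf fM); apply: proper_card.
by rewrite properE !fM /= (ltW yx) lt_geF.
Qed.

Lemma simplex_degree_covering (x y : P^d) :
  covering x y -> simplex_degree x = (simplex_degree y).+1.
Proof.
move=> [xy Nxy]; have yx : @Order.lt d P y x := xy.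
apply/eqP; rewrite eqn_leq simplex_degree_lt // andbT leqNgt.
apply/negP => lt2; apply: Nxy.
have [T [f [bf fM]]] := HP x.
have Ex := simplex_degree_face (lexx (x : P)) bf fM.
have Ey := simplex_degree_face (ltW yx) bf fM.
set X := val _ in Ex; set Y := val _ in Ey.
have YX : Y \proper X by rewrite properE !fM /= (ltW yx) lt_geF.
have [_ [t tX tY]] := properP YX.
have A0 : (t |: Y)%SET != finset.set0.
  by apply/set0Pn; exists t; rewrite setU11.
have [f' ff' f'f] := bf.
have e := f'f (exist (fun A : {set T} => is_true (A != finset.set0)) (t |: Y)%SET A0).
set z := f' _ in e; exists (val z : P^d).
have cA : #|(t |: Y)%SET| = (simplex_degree y).+2 by rewrite cardsU1 tY -Ey.
split; [change (@Order.lt d P (val z) x) | change (@Order.lt d P y (val z))].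
- rewrite lt_neqAle (valP z) andbT; apply/eqP => zx.
  have ez : z = exist _ x (lexx (x : P)) by apply: val_inj.
  by move: Ex lt2; rewrite /X -ez e /= cA => -[->]; rewrite ltnn.
- rewrite lt_neqAle; apply/andP; split.
    apply/eqP => yz.
    have ez : z = exist _ y (ltW yx) by apply: val_inj.
    by move: tY; rewrite /Y -ez e /= setU11.
  rewrite -[y]/(val (exist (fun q : P => is_true (q <= x)) y (ltW yx))) -fM e.
  exact: finset.subsetUr.
Qed.

Definition op_degree : decreasing_degree P^d :=
  DecreasingDegree simplex_degree_lt simplex_degree_covering.

Lemma finite_above_deg (i : P^d) (n : nat) :
  finite_set (above_deg op_degree i n).
Proof.
have [T [f [[f' ff' f'f] _]]] := HP i.
apply: (@sub_finite_set _ _ ((fun A => val (f' A) : P^d) @` setT)).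
  by move=> j [ij _]; exists (f (exist _ (j : P) ij)); rewrite ?ff'.
exact/finite_image/finite_finset.
Qed.

End SimplexDegree.

(* Main.v *)
(** Below [i0] the poset is that of the non-empty subsets of an [n+1]-element
    set, so [R p i0] is the binomial coefficient ['C(n, p)], the number of
    [(p+1)]-element subsets containing a given vertex.  Fix a well-order on the
    vertices and let [J i0 p] be the faces of dimension [p] of [i0] containing
    the least vertex of [i0].  Every face containing the least vertex of [i0]
    has the same least vertex, which is the compatibility required of a covering
    family. *)
Require Import Defs.
From mathcomp Require Import all_boot all_order all_algebra.
From mathcomp Require Import boolp classical_sets functions cardinality fsbigop.
From mathcomp Require wochoice.

Set Implicit Arguments.
Unset Strict Implicit.
Unset Printing Implicit Defensive.

Import Order.TTheory GRing.Theory.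

Local Open Scope classical_set_scope.
Local Open Scope order_scope.

(** Deleting [a] matches these sets with the [k]-element subsets of the complement of [a]. *)
Lemma card_draws_mem (T : finType) (a : T) (k : nat) :
  #|[set A : {set T} | (a \in A) && (#|A| == k.+1)]%SET| = 'C(#|T|.-1, k).
Proof.
rewrite -(cardsC1 a) -cards_draws.
set D := (X in _ = #|pred_of_set X|).
have DE A : (A \in D) = (a \notin A) && (#|A| == k).
  by rewrite finset.inE finset.subsetC finset.sub1set finset.inE.
have inj : {in D &, injective (fun A => a |: A)%SET}.
  move=> A B; rewrite !DE => /andP[aA _] /andP[aB _].
  by move=> /(congr1 (fun C => C :\ a)%SET); rewrite !setU1K.
rewrite -(card_in_imset inj); apply: eq_card => A; rewrite finset.inE.
apply/andP/imsetP => [[aA /eqP cA]|[B]].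
  exists (A :\ a)%SET; last by rewrite finset.setD1K.
  rewrite DE !finset.inE eqxx /=.
  by have := cardsD1 a A; rewrite aA cA add1n => -[->].
rewrite DE => /andP[aB /eqP cB] ->.
by rewrite setU11 cardsU1 aB cB.
Qed.

Section SimplexLikePoset.
Context {d : Order.disp_t} {P : porderType d}.
Hypothesis HP : simplex_like P.
Implicit Types p q r : P.

Local Notation deg := (simplex_degree HP).

(** A chart defined on all of [P] avoids carrying proofs of [q <= p]. Outside the faces of [p] it
    takes the default value [finset.set0], which no face of [p] attains. *)
Lemma simplex_chart p : exists (T : finType) (e : P -> {set T}),
  [/\ #|T| = (deg p).+1,
      forall q, q <= p -> #|e q| = (deg q).+1,
      forall q r, q <= p -> r <= p -> (e q \subset e r) = (q <= r) &
      forall A, A != finset.set0 -> exists2 q, q <= p & e q = A].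
Proof.
have [T [f [bf fM]]] := HP p.
pose e q : {set T} := if pselect (q <= p) is left H then val (f (exist _ q H))
                      else finset.set0.
have eE q (H : q <= p) : e q = val (f (exist _ q H)).
  by rewrite /e; case: pselect => // H'; congr (val (f _)); apply: val_inj.
have ecard q : q <= p -> #|e q| = (deg q).+1.
  by move=> H; rewrite (eE q H) (simplex_degree_face HP H bf fM).
have emono q r : q <= p -> r <= p -> (e q \subset e r) = (q <= r).
  by move=> Hq Hr; rewrite (eE q Hq) (eE r Hr) fM.
have esurj A : A != finset.set0 -> exists2 q, q <= p & e q = A.
  move=> A0; have [f' _ f'f] := bf.
  pose A' : nonempty_subset T := exist _ A A0; have le := valP (f' A').
  exists (val (f' A')) => //; rewrite (eE _ le).
  have <- : f' A' = exist (fun q => is_true (q <= p)) _ le by apply: val_inj.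
  by rewrite f'f.
(* [e p] is all of [T]: each singleton is the image of a face of [p], hence lies in [e p] by
   monotonicity. *)
exists T, e; split=> //; rewrite -(ecard p) // -cardsT; apply: eq_card => a.
have [|q qp eq] := esurj [set a]%SET; first by apply/set0Pn; exists a; rewrite set11.
by rewrite finset.inE -finset.sub1set -eq emono.
Qed.

(** One well-order on the whole of [P] serves all faces at once. The vertices of [q] are among those
    of [p], so the minimum for [p] stays minimal in [q] as soon as it belongs to [q]. *)
Lemma least_vertex : exists v : P -> P, forall p,
  [/\ v p <= p, deg (v p) = 0%N &
      forall q, q <= p -> v p <= q -> v q = v p].
Proof.
have [L wo] := wochoice.well_ordering_principle P.
pose V p := [pred x : P | (x <= p) && (deg x == 0)%N].
have Vne p : wochoice.nonempty (V p).
  have [T [e [cT ecard _ esurj]]] := simplex_chart p.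
  have /card_gt0P[a _] : (0 < #|T|)%N by rewrite cT.
  have [|q qp eq] := esurj [set a]%SET.
    by apply/set0Pn; exists a; rewrite set11.
  exists q; rewrite inE qp /=; move: (ecard q qp).
  by rewrite eq cards1 => -[<-].
have /choice[v vP] : forall p, exists x, unique (wochoice.minimum_of L (V p)) x.
  by move=> p; exact: wo (Vne p).
exists v => p; have [[+ vlb] _] := vP p; rewrite inE => /andP[vp /eqP v0].
split=> // q qp vq; have [_ uniqv] := vP q; apply: uniqv; split.
  by rewrite inE vq v0 eqxx.
move=> x; rewrite inE => /andP[xq x0]; apply: vlb.
by rewrite inE (le_trans xq qp).
Qed.

(** The chart turns a sum of ones over faces into the count of a finite family of subsets. It serves
    both the recursion for [R] and adequacy. *)
Lemma fsum1_faces p (T : finType) (e : P -> {set T}) (D : set P^d)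
    (B : {set {set T}}) (F : P^d -> int) :
    (forall q r, q <= p -> r <= p -> (e q \subset e r) = (q <= r)) ->
    (forall A, A != finset.set0 -> exists2 q, q <= p & e q = A) ->
    finset.set0 \notin B ->
    (forall q, D q <-> q <= p /\ e q \in B) ->
    (forall q, D q -> F q = 1%R) ->
  (\sum_(q \in D) F q)%R = #|B|%:R%R.
Proof.
move=> emono esurj B0 DB F1.
have -> : (\sum_(q \in D) F q = \sum_(q \in D) (1 : int))%R.
  by apply: eq_fsbigr => q; rewrite inE => /F1.
have ebij : set_bij D [set` B] (e : P^d -> {set T}).
  split.
  - by move=> q /DB[].
  - move=> q r; rewrite !inE => /DB[qp _] /DB[rp _] eqr.
    by apply: (@le_anti _ P); rewrite -(emono q r) // -(emono r q) // eqr subxx.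
  - move=> A /= AB; have [|q qp eq] := esurj A.
      by apply: contraNneq B0 => <-.
    by exists q => //; apply/DB; rewrite eq.
rewrite -(reindex_fsbig _ _ _ (fun=> 1%R) ebij).
rewrite -(@bigfs _ _ _ _ (index_enum {set T})) ?index_enum_uniq //.
  by rewrite sumr_const.
by move=> A _; rewrite mem_index_enum.
Qed.

(** Each [k]-dimensional face contributes ['C(k, k)], that is 1, so with [n = deg i] the recursion
    reads ['C(n.+1, k.+1) - 'C(n, k)], and Pascal's rule concludes. *)
Lemma R_binomial k (i : P^d) : R (op_degree HP) k i = ('C(deg i, k))%:R%R.
Proof.
elim: k i => [|k IH] i /=; first by rewrite bin0.
have [T [e [cT ecard emono esurj]]] := simplex_chart i.
have -> : (\sum_(j \in above_deg (op_degree HP) i k) R (op_degree HP) k j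
    = #|[set A : {set T} | #|A| == k.+1]%SET|%:R)%R.
  apply: (fsum1_faces emono esurj).
  - by rewrite finset.inE cards0.
  - move=> q; rewrite finset.inE; split.
      by move=> [qi /= <-]; split=> //; rewrite ecard.
    by move=> [qi]; rewrite ecard // => /eqP[<-]; split.
  - by move=> q [_ /= dq]; rewrite IH dq binn.
by rewrite card_draws cT IH binS natrD addrK.
Qed.

(** Two proper faces are joined through a vertex of each and the edge spanned by these two
    vertices. *)
Lemma above_connected (i : P^d) : (2 <= deg i)%N -> poset_connected (above i).
Proof.
move=> deg2; have [T [e [cT ecard emono esurj]]] := simplex_chart i.
(* [T] has at least three elements, so vertices and edges are proper faces. *)
have small (A : {set T}) : A != finset.set0 -> (#|A| <= 2)%N ->
    exists2 q : P^d, above i q & e q = A.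
  move=> A0 A2; have [q qi eq] := esurj A A0; exists q => //.
  change (@Order.lt d P q i); rewrite lt_neqAle qi andbT.
  apply/eqP => qE; move: A2; rewrite -eq ecard // qE.
  by rewrite ltnNge deg2.
have vertex (q : P^d) : above i q -> exists (a : P^d) (x : T),
    [/\ above i a, e a = [set x]%SET & (q : P^d) <= a].
  move=> iq; have qi : @Order.le d P q i := ltW iq.
  have /set0Pn[x xq] : e q != finset.set0 by rewrite -card_gt0 ecard.
  have [|//|a ia ea] := small [set x]%SET.
  - by rewrite -card_gt0 cards1.
  - by rewrite cards1.
  exists a, x; split=> //; change (@Order.le d P a q).
  by rewrite -emono ?ea ?finset.sub1set //; exact: (ltW ia).
split.
  have /card_gt0P[x _] : (0 < #|T|)%N by rewrite cT.
  have [||a ia _] := small [set x]%SET; rewrite -?card_gt0 ?cards1 //.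
  by exists a.
move=> y z iy iz.
have [a [x [ia ea ya]]] := vertex y iy; have [b [t [ib eb zb]]] := vertex z iz.
(* If [x = t], this edge degenerates to a vertex and the zigzag remains valid. *)
have [||c ic ec] := small [set x; t]%SET.
- by apply/set0Pn; exists x; rewrite !finset.inE eqxx.
- by rewrite cards2; case: eqP.
have ca : c <= a.
  change (@Order.le d P a c); rewrite -emono ?ea ?ec; first exact: finset.subsetUl.
  - exact: (ltW ia).
  - exact: (ltW ic).
have cb : c <= b.
  change (@Order.le d P b c); rewrite -emono ?eb ?ec; first exact: finset.subsetUr.
  - exact: (ltW ib).
  - exact: (ltW ic).
exists [:: a; c; b; z]; split=> //=.
  by rewrite /Order.comparable ya ca cb zb !orbT.
by move=> w; rewrite /= !inE => /or4P[] /eqP->.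
Qed.

Lemma face_between_vertex p q x k : q <= p -> x <= p -> deg x = 0%N ->
    deg q = k -> (k < deg p)%N ->
  exists r, [/\ r <= p, deg r = k.+1, x <= r & q <= r].
Proof.
move=> qp xp x0 qk kp.
have [T [e [cT ecard emono esurj]]] := simplex_chart p.
have [a ea] : exists a, e x = [set a]%SET.
  by apply/cards1P; rewrite ecard // x0.
(* The vertex added to [q] is [a] if [q] misses it, and otherwise any vertex outside [q], which
   exists because [k < deg p]. *)
have [b [bq sub]] : exists b, b \notin e q /\ a \in b |: e q.
  have [aq|aq] := boolP (a \in e q); last by exists a; rewrite aq setU11.
  have [b] : exists b, b \in (~: e q)%SET.
    apply/card_gt0P; have := cardsC (e q); rewrite ecard // qk cT => H.
    by rewrite -(ltn_add2l k.+1) H addn0.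
  by rewrite finset.inE => bq; exists b; split=> //; rewrite setU1r.
have [|r rp er] := esurj (b |: e q)%SET; first by apply/set0Pn; exists b; rewrite setU11.
exists r; split=> //.
- by apply: succn_inj; rewrite -ecard // er cardsU1 bq ecard // qk.
- by rewrite -emono // er ea finset.sub1set.
- by rewrite -emono // er finset.subsetUr.
Qed.

End SimplexLikePoset.

Theorem lemma5p4p8 (d : Order.disp_t) (P : porderType d)
    (HP : simplex_like P) :
  exists J : P^d -> nat -> set P^d,
    covering_family (op_degree HP) J /\ adequate (op_degree HP) J.
Proof.
have [v vP] := least_vertex HP.
pose J (i : P^d) k := above_deg (op_degree HP) i k
  `&` [set j : P^d | @Order.le d P (v i) j].
exists J; split; split.
- by move=> i k _ j [].
- move=> i k ki; have [vi v0 vmin] := vP i; split; last first.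
    (* Since [j] contains [v i], its own least vertex is [v i], so both families ask for the same
       vertex. *)
    move=> j [[ij _] vj] l [[jl lk]]; rewrite /= (vmin j ij vj) => vl.
    by split=> //; split=> //; exact: le_trans ij jl.
  apply/seteqP; split.
    by move=> l [j [[ij _] _] [jl lk]]; split=> //; exact: le_trans ij jl.
  move=> l [il lk].
  have [r [ri rk vr lr]] := face_between_vertex (il : @Order.le d P l i) vi v0 lk ki.
  by exists r; split.
- exact: above_connected.
- move=> i k ki; rewrite R_binomial.
  have [vi v0 _] := vP i.
  have [T [e [cT ecard emono esurj]]] := simplex_chart HP i.
  have [a ea] : exists a, e (v i) = [set a]%SET.
    by apply/cards1P; rewrite ecard // v0.
  have -> : simplex_degree HP i = #|T|.-1 by rewrite cT.
  (* Every summand is ['C(k, k)], that is 1, so the sum counts the [k.+1]-element subsets of [T]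
     containing the least vertex [a]. *)
  rewrite -(card_draws_mem a); apply/esym/(fsum1_faces emono esurj).
  + by rewrite !finset.inE.
  + move=> q; rewrite finset.inE; split.
      move=> [[iq /= qk] vq]; split=> //.
      by rewrite ecard // qk eqxx andbT -finset.sub1set -ea emono.
    move=> [qi /andP[aq]]; rewrite ecard // => /eqP[qk]; split; first by split.
    by rewrite /= -emono // ea finset.sub1set.
  + by move=> q [[_ /= qk] _]; rewrite R_binomial qk binn.
Qed.
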